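(* Let $1\le d\le n$ be integers, let $A_1,\dots,A_n$ be self-adjoint bounded operators on a Hilbert space, and set $a_i=A_i-1$. Suppose that (i) $P_1(A_1,\dots,A_n)=\frac1n\sum_{i=1}^n A_i=1$ (equivalently $\sum_i A_i=n\cdot 1$), and (ii) $\Big\|\big(\sum_{j=1}^n a_j^2\big)^{1/2}\Big\|\le \frac{n}{3d}$. Then $$P_d(A_1,\dots,A_n)\le P_1(A_1,\dots,A_n)^d=1 .$$
   Context: For bounded operators $A_1,\dots,A_n$ and $1\le d\le n$, $$P_d(A_1,\dots,A_n)=\frac{(n-d)!}{n!}\sum_{\substack{1\le j_1,\dots,j_d\le n\\ \text{all different}}}A_{j_1}A_{j_2}\cdots A_{j_d}.$$ Here $x\le y$ means that $y-x$ is positive semidefinite, $1$ is the identity operator, and $\|\cdot\|$ is the operator norm. *)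

(* Defs.v *)
From HB Require Import structures.
From mathcomp Require Import all_boot all_order all_algebra.
From mathcomp Require Export complex.
From mathcomp Require Import all_classical all_reals all_analysis.

Set Implicit Arguments.
Unset Strict Implicit.
Unset Printing Implicit Defensive.

Import Order.TTheory GRing.Theory Num.Theory.
Import numFieldNormedType.Exports.

Local Open Scope classical_set_scope.
Local Open Scope ring_scope.

(* Operators on [H] are plain functions [H -> H], added and scaled pointwise by
   the library's structure on functions; their product is composition and their
   identity is [idfun]. *)
Section Operators.
Variables (R : realType) (H : completeNormedModType R[i]).
Implicit Types (S T : H -> H).

Definition bounded_op T : Prop :=
  linear T /\ exists M : R, forall x : H, `|T x| <= (M%:C)%C * `|x|.

(* The norm of [H] takes its (real) values in [R[i]], whence the real part. *)
Definition op_norm T : R :=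
  sup [set complex.Re `|T x| | x in [set x : H | `|x| <= 1]].

Definition op_exp T (k : nat) : H -> H := \big[comp/idfun]_(i < k) T.

Definition P (n d : nat) (A : 'I_n -> H -> H) : H -> H :=
  ((n - d)`!%:R / n`!%:R : R[i]) *:
    \sum_(j : {ffun 'I_d -> 'I_n} | injectiveb j)
      \big[comp/idfun]_(k < d) A (j k).

Variable dot : {dot H for (@Num.conj R[i])}.

(* [dot] is the inner product from which the norm of [H] arises; it is linear
   in its first argument and conjugate-linear in the second. *)
Definition hilbert_dot : Prop := forall x : H, `|x| ^+ 2 = dot x x.

Definition selfadjoint T : Prop := forall x y : H, dot (T x) y = dot x (T y).

(* In [R[i]], [0 <= z] means that [z] is real and nonnegative. *)
Definition psd T : Prop := forall x : H, 0 <= dot (T x) x.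

Definition op_le S T : Prop := psd (T - S).

Definition is_op_sqrt T S : Prop := [/\ bounded_op S, psd S & S \o S = T].

(* The positive square root of a positive operator [T]; it is [0], by
   convention, if [T] has none. *)
Definition op_sqrt T : H -> H := xget 0 [set S | is_op_sqrt T S].

End Operators.

Arguments P {R H n} d A.

(* Main.v *)
Require Import Defs.
From HB Require Import structures.
From mathcomp Require Import all_boot all_order all_fingroup all_algebra.
From mathcomp Require Import complex.
From mathcomp Require Import all_classical all_reals all_analysis.
From mathcomp Require Import ring lra.

Import Order.TTheory GRing.Theory Num.Theory.
Import numFieldNormedType.Exports.

Set Implicit Arguments.
Unset Strict Implicit.
Unset Printing Implicit Defensive.

Local Open Scope ring_scope.

(* Put [rho = n / (3 d)], [Q = sum_i a_i^2], and let [E_k] be the sum of the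
   products [a_(j 1) ... a_(j k)] over injective [j]. Expanding [A_i = 1 + a_i],
   [P_d(A) = sum_k C(d,k) (n-k)!/n! E_k] with [E_0 = 1], [E_1 = 0] and
   [E_2 = - Q]. The indicator of injectivity of [j] is the determinant of the
   matrix [(j p = j r)_(p, r)], so [E_k] is a signed sum over the permutations
   [s] of [k] points of the sums over the [j] that are constant on the cycles of
   [s]. Such a sum vanishes if [s] has a fixed point, because [sum_i a_i = 0];
   otherwise it factors through rows, columns and diagonals made of the [a_i],
   whence its quadratic form is at most [rho^(k-2) Q]. Thus
   [|<E_k x, x>| <= k! rho^(k-2) <Q x, x>], and comparison with the geometric
   series of ratio 1/3, whose sum from the exponent 1 on is 1/2, shows that the
   terms with [k >= 3] are dominated by the term [k = 2].
   That hypothesis (ii) gives [Q <= rho^2] requires a square root of [Q] to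
   exist, since [op_sqrt] is [0] otherwise. *)

(** * Sums over injective words *)

Section InjectiveWords.
Variables (R : nzRingType) (V : lmodType R) (I : finType).
Implicit Types (U : {set I}) (x : V).

(** [U] collects the letters already used, so that an injective word can be built from its outermost
    factor inwards. *)
Fixpoint inj_words (f : I -> V -> V) (d : nat) U x : V :=
  if d is d'.+1 then \sum_(j | j \notin U) f j (inj_words f d' (j |: U) x)
  else x.

(** Exchange the sums: an injective word of length [k] outside [U] leaves [#|I| - #|U| - k] choices
    for the extra letter [j] that it must avoid. *)
Lemma sum_inj_words (f : I -> {linear V -> V}) k U x :
  \sum_(j | j \notin U) inj_words f k (j |: U) x =
  inj_words f k U x *+ (#|I| - #|U| - k).
Proof.
elim: k U => [|k IH] U /=.
  by rewrite sumr_const subn0 -(cardsC U) addKn; congr (_ *+ _); apply: eq_card => j; rewrite inE.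
transitivity (\sum_(i | i \notin U) f i
    (\sum_(j | j \notin i |: U) inj_words f k (j |: (i |: U)) x)).
  rewrite (exchange_big_dep (fun i => i \notin U)) /=; last first.
    by move=> j i _; rewrite !inE negb_or => /andP[].
  apply: eq_bigr => i iU; rewrite linear_sum /=.
  apply: eq_big => [j|j /andP[jU]].
    by rewrite !inE !negb_or (eq_sym i) andbC iU andbT.
  by move=> _; rewrite finset.setUCA.
rewrite -sumrMnl; apply: eq_bigr => i iU.
rewrite IH cardsU1 iU raddfMn /=; congr (_ *+ _).
by rewrite -!subnDA add1n addnS addSn.
Qed.

(** Choose the [k] positions where [f] is taken from [f + 1]; the other [d - k] letters act as the
    identity and only contribute the number of ways to place them injectively. *)
Lemma inj_words_add_id (f : I -> {linear V -> V}) (g : I -> V -> V) d U x :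
    (forall i y, g i y = f i y + y) ->
  inj_words g d U x =
  \sum_(k < d.+1) inj_words f k U x *+ ('C(d, k) * (#|I| - #|U| - k) ^_ (d - k)).
Proof.
move=> gE; elim: d U => [|d IH] U.
  by rewrite big_ord1 /= bin0 ffactn0.
pose N := (#|I| - #|U|)%N.
(* The outermost factor is [f j] in the first sum and the identity in the second, where
   [sum_inj_words] counts the idle letter [j]. Pascal's rule then merges the two. *)
have -> : inj_words g d.+1 U x =
    \sum_(k < d.+1) inj_words f k.+1 U x *+
       ('C(d, k) * (N - k.+1) ^_ (d - k)) +
    \sum_(k < d.+1) inj_words f k U x *+
       ('C(d, k) * (N - k) ^_ (d.+1 - k)).
  have cU j : j \notin U -> (#|I| - #|j |: U| = N.-1)%N.
    by move=> jU; rewrite cardsU1 jU add1n subnS.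
  rewrite /=; under eq_bigr do rewrite gE.
  rewrite big_split /=; congr (_ + _).
    under eq_bigr => j jU do rewrite IH linear_sum.
    rewrite exchange_big /=; apply: eq_bigr => k _.
    rewrite -sumrMnl; apply: eq_bigr => j jU.
    by rewrite linearMn (cU _ jU) -subn1 -subnDA add1n.
  under eq_bigr => j jU do rewrite IH.
  rewrite exchange_big /=; apply: eq_bigr => k _.
  under eq_bigr => j jU do rewrite (cU _ jU).
  rewrite sumrMnl sum_inj_words -mulrnA; congr (_ *+ _).
  rewrite mulnCA subSn; last by rewrite -ltnS.
  by rewrite ffactnS -/N -!subn1 -!subnDA (addnC 1%N).
rewrite [RHS]big_ord_recl [X in _ + X = _]big_ord_recl /=.
rewrite addrCA !bin0; congr (_ + _).
(* The top term can be added because ['C(d, d.+1) = 0]. *)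
rewrite (_ : \sum_(i < d) _ = \sum_(i < d.+1) inj_words f i.+1 U x *+
   ('C(d, i.+1) * (N - i.+1) ^_ (d.+1 - i.+1))); last first.
  by rewrite [RHS]big_ord_recr /= bin_small // mul0n mulr0n addr0.
rewrite -big_split /=; apply: eq_bigr => k _.
by rewrite -mulrnDr /bump leq0n add1n subSS binS addnC -mulnDl.
Qed.

Definition fcons d (p : I * {ffun 'I_d -> I}) : {ffun 'I_d.+1 -> I} :=
  [ffun i => if unlift ord0 i is Some k then p.2 k else p.1].

Lemma fcons0 d p : @fcons d p ord0 = p.1.
Proof. by rewrite ffunE unlift_none. Qed.

Lemma fcons_lift d p k : @fcons d p (lift ord0 k) = p.2 k.
Proof. by rewrite ffunE liftK. Qed.

Lemma fcons_bij d : bijective (@fcons d).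
Proof.
exists (fun j : {ffun 'I_d.+1 -> I} =>
  (j ord0, [ffun k => j (lift ord0 k)]) : I * {ffun 'I_d -> I}) => [[i j]|j].
  by rewrite fcons0; congr pair; apply/ffunP => k; rewrite ffunE fcons_lift.
apply/ffunP => k; case: (unliftP ord0 k) => [l ->|->]; last by rewrite fcons0.
by rewrite fcons_lift ffunE.
Qed.

(** Cut [j] into head and tail: [j] is injective and avoids [U] exactly if its head avoids [U] and
    its tail is injective and avoids both [U] and the head. *)
Lemma inj_words_ffun (f : I -> {linear V -> V}) d U x :
  \sum_(j : {ffun 'I_d -> I} | injectiveb j && [forall k, j k \notin U])
     (\big[comp/idfun]_(k < d) (f (j k) : V -> V)) x =
  inj_words f d U x.
Proof.
elim: d U => [|d IH] U.
  rewrite (big_pred1 (ffun0 (card_ord 0))) => [|j]; first by rewrite big_ord0.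
  have -> : j = ffun0 (card_ord 0) by apply/ffunP => -[].
  rewrite /= eqxx; apply/andP; split; last by apply/forallP => -[].
  by apply/injectiveP => -[].
rewrite (reindex (@fcons d)) /=; last exact/onW_bij/fcons_bij.
rewrite [RHS](eq_bigr _ (fun j _ => congr1 (f j) (esym (IH (j |: U))))).
under [RHS]eq_bigr do rewrite linear_sum.
rewrite pair_big_dep /=; apply: eq_big => [[i j]|[i j] _] /=; last first.
  rewrite big_ord_recl /= fcons0; congr (f i _).
  by congr (_ x); apply: eq_bigr => k _; rewrite fcons_lift.
apply/andP/and3P => [[/injectiveP inj /forallP avoid]|[iU]].
  split; first by have := avoid ord0; rewrite fcons0.
    apply/injectiveP => k l eq_kl; apply: (@lift_inj _ ord0); apply: inj.
    by rewrite !fcons_lift.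
  apply/forallP => k; have := avoid (lift ord0 k); rewrite fcons_lift !inE negb_or => -> /=.
  rewrite andbT; apply/eqP => jk; have /inj : fcons (i, j) (lift ord0 k) = fcons (i, j) ord0.
    by rewrite fcons0 fcons_lift.
  by move/eqP; rewrite eq_sym (negPf (neq_lift _ _)).
move=> /injectiveP inj /forallP avoid; split.
  apply/injectiveP => k l.
  case: (unliftP ord0 k) => [k' ->|->]; case: (unliftP ord0 l) => [l' ->|->] //;
    rewrite ?fcons0 ?fcons_lift /=.
  - by move=> /inj ->.
  - by move=> jk; have := avoid k'; rewrite jk !inE eqxx.
  - by move=> jl; have := avoid l'; rewrite -jl !inE eqxx.
apply/forallP => k; case: (unliftP ord0 k) => [l ->|->]; rewrite ?fcons0 //.
by rewrite fcons_lift; have := avoid l; rewrite inE negb_or => /andP[].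
Qed.
End InjectiveWords.

(** * Words in self-adjoint operators *)

Section HermitianForms.
Variables (C : numClosedFieldType) (V : lmodType C).

(** Positivity at [x - s * f x y *: y] gives a quadratic inequality in the real number [s], used at
    [s = 1 / f y y]. The form may be degenerate, so [f y y = 0] is treated apart. *)
Lemma psd_form_CauchySchwarz (f : V -> V -> C) x y :
    (forall u v w, f (u + v) w = f u w + f v w) ->
    (forall a u v, f (a *: u) v = a * f u v) ->
    (forall u v, f v u = (f u v)^*) ->
    (forall u, 0 <= f u u) ->
  `|f x y| ^+ 2 <= f x x * f y y.
Proof.
move=> fD fZ fC f_ge0.
have fDr v u w : f v (u + w) = f v u + f v w.
  by rewrite fC fD rmorphD /= -!fC.
have fZr a u v : f u (a *: v) = a^* * f u v by rewrite fC fZ rmorphM /= -fC.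
have quad s : s \is Num.real ->
    0 <= f x x - 2 * s * `|f x y| ^+ 2 + s ^+ 2 * `|f x y| ^+ 2 * f y y.
  move=> s_real; have := f_ge0 (x + (- (s * f x y)) *: y).
  rewrite fD !fDr !fZ !fZr (fC x y) rmorphN rmorphM /= (CrealP s_real) normCK.
  by congr (0 <= _); ring.
have [fyy0|fyy_neq0] := eqVneq (f y y) 0.
  rewrite fyy0 mulr0; have [->//|N_neq0] := eqVneq (`|f x y| ^+ 2) 0.
  (* When [f y y = 0] the expression is affine in [s], and at this [s] it would equal [-1]. *)
  have s_real : (f x x + 1) / (2 * `|f x y| ^+ 2) \is Num.real.
    by rewrite ger0_real // divr_ge0 ?addr_ge0 ?mulr_ge0 ?exprn_ge0.
  have := quad _ s_real.
  rewrite fyy0 mulr0 addr0; move: N_neq0; set N := `|f x y| ^+ 2 => N_neq0.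
  by rewrite (_ : f x x - _ = -1) ?ler0N1 //; field.
have fyy_gt0 : 0 < f y y by rewrite lt_def fyy_neq0 f_ge0.
have := quad (f y y)^-1; rewrite (_ : _ + _ = f x x - `|f x y| ^+ 2 / f y y).
  rewrite subr_ge0 ler_pdivrMr //; apply; apply: ger0_real.
  by rewrite invr_ge0 ltW.
by field.
Qed.

End HermitianForms.

Section InnerProduct.
Variables (C : numClosedFieldType) (V : lmodType C) (dot : {dot V for Num.conj}).

Lemma dotC u v : dot v u = (dot u v)^*.
Proof. by rewrite hermC expr0 mul1r. Qed.

Lemma dotDl u v w : dot (u + v) w = dot u w + dot v w.
Proof. exact: linearDl. Qed.

Lemma dotDr u v w : dot u (v + w) = dot u v + dot u w.
Proof. exact: linearDr. Qed.

Lemma dotZl c u v : dot (c *: u) v = c * dot u v.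
Proof. exact: linearZl_LR. Qed.

Lemma dotZr c u v : dot u (c *: v) = c^* * dot u v.
Proof. exact: linearZr_LR. Qed.

Lemma dot_ge0 u : 0 <= dot u u. Proof. exact: dnorm_ge0. Qed.

Lemma sum_dot_CauchySchwarz (J : finType) (v w : J -> V) :
  `|\sum_j dot (v j) (w j)| ^+ 2 <=
    (\sum_j dot (v j) (v j)) * (\sum_j dot (w j) (w j)).
Proof.
pose f (u t : {ffun J -> V}) := \sum_j dot (u j) (t j).
have := @psd_form_CauchySchwarz C {ffun J -> V} f (finfun v) (finfun w).
have fE (u t : J -> V) : f (finfun u) (finfun t) = \sum_j dot (u j) (t j).
  by apply: eq_bigr => j _; rewrite !ffunE.
rewrite !fE; apply; rewrite /f.
- move=> u t z; rewrite -big_split; apply: eq_bigr => j _.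
  by rewrite ffunE linearDl.
- move=> a u t; rewrite mulr_sumr; apply: eq_bigr => j _.
  by rewrite ffunE linearZl_LR.
- by move=> u t; rewrite rmorph_sum; apply: eq_bigr => j _; rewrite dotC.
- by move=> u; apply: sumr_ge0 => j _; apply: dot_ge0.
Qed.
End InnerProduct.

(** * Bounds for sums of words whose letters are governed by labels *)

Section LabelledWords.
Variables (C : numClosedFieldType) (V : lmodType C) (dot : {dot V for Num.conj}).
Variables (I B : finType).
Implicit Types (e : {ffun B -> I}) (v : {ffun B -> I} -> V) (O : {set B}).

Definition upd e (b : B) (i : I) : {ffun B -> I} :=
  [ffun c => if c == b then i else e c].

Lemma upd_eq e b i : upd e b i b = i.
Proof. by rewrite ffunE eqxx. Qed.

Lemma upd_neq e b i c : c != b -> upd e b i c = e c.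
Proof. by move=> /negPf cb; rewrite ffunE cb. Qed.

Lemma upd_upd e b i j : upd (upd e b i) b j = upd e b j.
Proof. by apply/ffunP => c; rewrite !ffunE; case: eqP. Qed.

Lemma updC e b c i j : b != c -> upd (upd e b i) c j = upd (upd e c j) b i.
Proof.
by move=> /negPf bc; apply/ffunP => d; rewrite !ffunE; case: eqP => // ->; rewrite eq_sym bc.
Qed.

Lemma upd_id e b : upd e b (e b) = e.
Proof. by apply/ffunP => c; rewrite ffunE; case: eqP => // ->. Qed.

(** Exchanging [i] with the value of [e] at [b] is an involution on the pairs [(e, i)]; it turns the
    summand into [F e], which is free of [i]. *)
Lemma sum_upd (W : nmodType) (F : {ffun B -> I} -> W) b :
  \sum_e \sum_i F (upd e b i) = (\sum_e F e) *+ #|I|.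
Proof.
pose swap (p : {ffun B -> I} * I) := (upd p.1 b p.2, p.1 b).
have swapK : involutive swap.
  by move=> [e i]; rewrite /swap /= upd_upd upd_eq upd_id.
rewrite pair_big (reindex_inj (inv_inj swapK)) /=.
under eq_bigr do rewrite upd_upd upd_id.
rewrite -(pair_bigA _ (fun e _ => F e)) /= -sumrMnl.
by apply: eq_bigr => e _; rewrite sumr_const.
Qed.

Variable a : I -> {linear V -> V}.

(** The first letter of [w] acts first, so the word is the operator product read from right to
    left. *)
Definition act e (w : seq B) (x : V) : V := foldl (fun y b => a (e b) y) x w.

Lemma act_linear e w : linear (act e w).
Proof.
elim: w => [|b w IH] c x y //=.
by rewrite linearP IH.
Qed.
HB.instance Definition _ e w := GRing.isLinear.Build C V V _ (act e w) (act_linear e w).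

Lemma act_upd e b i w x : b \notin w -> act (upd e b i) w x = act e w x.
Proof.
elim: w x => //= c w IH x; rewrite inE negb_or => /andP[bc bw].
by rewrite IH // upd_neq // eq_sym.
Qed.

Hypothesis I_gt0 : (0 < #|I|)%N.
Hypothesis a_selfadj : forall i x y, dot (a i x) y = dot x (a i y).
Variable rho2 : C.
Let q x := \sum_i dot (a i x) (a i x).
Hypothesis q_le : forall x, q x <= rho2 * dot x x.
Hypothesis rho2_ge0 : 0 <= rho2.

Let n : C := #|I|%:R.
Let n_gt0 : 0 < n. Proof. by rewrite ltr0n. Qed.
Let n_neq0 : n != 0. Proof. exact: lt0r_neq0. Qed.

Let q_ge0 x : 0 <= q x.
Proof. by apply: sumr_ge0 => i _; apply: dot_ge0. Qed.

(** The row is the adjoint of the column [(a i)_i]: with [z] the left-hand vector, Cauchy-Schwarz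
    gives [dot z z ^+ 2 <= S * q z <= S * rho2 * dot z z], and one factor [dot z z] cancels. *)
Lemma row_bound (u : I -> V) :
  dot (\sum_i a i (u i)) (\sum_i a i (u i)) <= rho2 * \sum_i dot (u i) (u i).
Proof.
set z := \sum_i _; set S := \sum_i _.
have S_ge0 : 0 <= S by apply: sumr_ge0 => i _; apply: dot_ge0.
have zz : dot z z = \sum_i dot (u i) (a i z).
  by rewrite {1}/z linear_sumlz; apply: eq_bigr => i _; apply: a_selfadj.
have [->|z_neq0] := eqVneq (dot z z) 0; first exact: mulr_ge0.
have z_gt0 : 0 < dot z z by rewrite lt_def z_neq0 dot_ge0.
rewrite -(ler_pM2l z_gt0) -expr2 -{1}(ger0_norm (dot_ge0 dot z)) {1}zz.
apply: (le_trans (sum_dot_CauchySchwarz _ _ _)).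
apply: (@le_trans _ _ (S * (rho2 * dot z z))); first exact: ler_wpM2l (q_le z).
by rewrite mulrCA (mulrC S) mulrCA.
Qed.

(* Read [w] from left to right, a label being open between its first and its
   last occurrence. The state [v] depends only on the values of the open
   labels, those in [O]. Opening a label multiplies by the column [(a i)_i],
   closing it multiplies by the row [(a i)_i], and a middle occurrence
   multiplies by the diagonal, each of norm at most [sqrt rho2]. Since [v] is
   summed over the values of all labels, opened or not, every opening and every
   closing moreover gains a factor [1 / n]: the exponent on the left of
   [word_bound] counts them. The last letter is moved to [y]. *)
Definition depends_on O v := forall b, b \notin O -> forall e i, v (upd e b i) = v e.

Let sqnorm v := \sum_e dot (v e) (v e).

Let sqnorm_upd v b : n * sqnorm v = \sum_e \sum_i dot (v (upd e b i)) (v (upd e b i)).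
Proof. by rewrite (sum_upd (fun e => dot (v e) (v e))) mulr_natl. Qed.

Let open_bound b O v : b \notin O -> depends_on O v ->
  n * sqnorm (fun e => a (e b) (v e)) = \sum_e q (v e).
Proof.
move=> bO dep; rewrite (sqnorm_upd _ b); apply: eq_bigr => e _.
by apply: eq_bigr => i _; rewrite upd_eq dep.
Qed.

Let close_bound b v :
  n * sqnorm (fun e => n^-1 *: \sum_i a i (v (upd e b i))) <= rho2 * sqnorm v.
Proof.
rewrite -(ler_pM2l n_gt0) [leRHS]mulrCA (sqnorm_upd v b) !mulr_sumr.
apply: ler_sum => e _; rewrite /= dnormZ normfV gtr0_norm // !mulrA.
by rewrite mulfK // divff // mul1r row_bound.
Qed.

Let middle_bound b v : sqnorm (fun e => a (e b) (v e)) <= rho2 * sqnorm v.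
Proof.
rewrite mulr_sumr; apply: ler_sum => e _; apply: le_trans (q_le _).
by rewrite /q (bigD1 (e b)) //= lerDl sumr_ge0 // => i _; apply: dot_ge0.
Qed.

(** Once [b] no longer occurs in [w], its value can be summed out. The factor [n^-1] compensates for
    the sum over [e], which still runs over the now idle value of [b]. *)
Let close_sum b v w y : b \notin w ->
  \sum_e dot (act e w (n^-1 *: \sum_i a i (v (upd e b i)))) y =
  \sum_e dot (act e (b :: w) (v e)) y.
Proof.
move=> bw.
have -> : \sum_e dot (act e (b :: w) (v e)) y =
    n^-1 * \sum_e \sum_i dot (act (upd e b i) (b :: w) (v (upd e b i))) y.
  by rewrite (sum_upd (fun e => dot (act e (b :: w) (v e)) y)) -[X in _ * X]mulr_natl mulKf.
rewrite mulr_sumr; apply: eq_bigr => e _.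
rewrite linearZ linear_sum linearZl_LR linear_sumlz /=; congr (_ * _).
by apply: eq_bigr => i _; rewrite /= upd_eq act_upd.
Qed.

Lemma word_bound w O v y :
    w != [::] -> depends_on O v -> {subset O <= w} ->
    (forall b, b \notin O -> b \in w -> (1 < count_mem b w)%N) ->
  n ^+ (size (undup w) + count [predC O] (undup w)) *
     `|\sum_e dot (act e w (v e)) y| ^+ 2 <=
  n ^+ #|B| * (rho2 ^+ (size w).-1 * q y * sqnorm v).
Proof.
elim: w O v => // b w IH O v _ dep sub cnt.
have sub' c : c \in O -> c != b -> c \in w.
  by move=> /sub; rewrite inE => /orP[->|].
have cnt' c : c \notin O -> c \in w -> c != b -> (1 < count_mem c w)%N.
  move=> cO cw cb; have := cnt c cO; rewrite inE cw orbT /= eq_sym (negPf cb).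
  exact.
case: w => [|b' w'] in IH sub' cnt' cnt sub *.
  (* A label still to be opened occurs at least twice, so the label of a final letter is open. *)
  have bO : b \in O.
    by apply/negPn/negP => bO; have := cnt b bO; rewrite inE eqxx /= eqxx => /(_ isT).
  rewrite /= bO /= expr1 expr0 mul1r.
  under eq_bigr do rewrite a_selfadj.
  have := sum_dot_CauchySchwarz dot v (fun e => a (e b) y).
  move=> /(ler_wpM2l (ltW n_gt0)) /le_trans; apply.
  rewrite -/(sqnorm v) -/(sqnorm (fun e => a (e b) y)) mulrCA.
  rewrite (sqnorm_upd (fun e => a (e b) y) b).
  under eq_bigr do under eq_bigr do rewrite upd_eq.
  rewrite -/(q y) sumr_const card_ffun -mulr_natl natrX -/n.
  by rewrite mulrCA (mulrC (q y)).
move: (b' :: w') (isT : b' :: w' != [::]) IH sub' cnt' cnt sub.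
move=> {b' w'} w w_neq0 IH sub' cnt' cnt sub.
have IHw O' v' := IH O' v' w_neq0.
(* One letter is consumed at the cost of a factor [rho2], and [d] is the drop of the exponent of
   [n]: 1 if the letter closes or opens its label, 0 for a middle occurrence. These cases follow in
   the order closing, middle, opening. *)
have step (O' : {set B}) v' (d : nat) :
    depends_on O' v' -> {subset O' <= w} ->
    (forall c, c \notin O' -> c \in w -> (1 < count_mem c w)%N) ->
    \sum_e dot (act e (b :: w) (v e)) y = \sum_e dot (act e w (v' e)) y ->
    (size (undup (b :: w)) + count [predC O] (undup (b :: w)) =
      d + (size (undup w) + count [predC O'] (undup w)))%N ->
    n ^+ d * sqnorm v' <= rho2 * sqnorm v ->
  n ^+ (size (undup (b :: w)) + count [predC O] (undup (b :: w))) *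
     `|\sum_e dot (act e (b :: w) (v e)) y| ^+ 2 <=
  n ^+ #|B| * (rho2 ^+ size w * q y * sqnorm v).
  move=> dep' sub1 cnt1 -> -> vv'; rewrite exprD -mulrA.
  apply: le_trans (ler_wpM2l (exprn_ge0 _ (ltW n_gt0)) (IHw O' v' dep' sub1 cnt1)) _.
  rewrite mulrCA ler_wpM2l ?exprn_ge0 ?(ltW n_gt0) //.
  rewrite mulrCA (_ : rho2 ^+ size w = rho2 ^+ (size w).-1 * rho2); last first.
    by rewrite -exprSr prednK // lt0n size_eq0.
  rewrite (mulrAC _ rho2) -[leRHS]mulrA ler_wpM2l ?mulr_ge0 ?exprn_ge0 //.
have [bw|bw] := boolP (b \in w); last first.
  have bO : b \in O.
    apply/negPn/negP => bO; have := cnt b bO; rewrite inE eqxx /= eqxx => /(_ isT).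
    by rewrite add1n ltnS -has_count has_pred1 (negPf bw).
  apply: (step (O :\ b) (fun e => n^-1 *: \sum_i a i (v (upd e b i))) 1%N).
  - move=> c; rewrite !inE negb_and negbK => /orP[/eqP ->|cO] e i.
      by under eq_bigr do rewrite upd_upd.
    have [->|cb] := eqVneq c b; first by under eq_bigr do rewrite upd_upd.
    by under eq_bigr do rewrite updC // dep //.
  - by move=> c; rewrite !inE => /andP[cb cO]; apply: sub'.
  - move=> c; rewrite !inE negb_and negbK => /orP[/eqP ->|cO] cw; first by rewrite cw in bw.
    by apply: cnt' => //; apply: contraNneq bw => <-.
  - by rewrite close_sum.
  - rewrite /= (negPf bw) /= bO /= add0n addSn; congr (_.+1 + _)%N.
    apply: eq_in_count => c; rewrite mem_undup !inE => cw.
    by rewrite (_ : c != b) //; apply: contraNneq bw => <-.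
  - by rewrite expr1 close_bound.
have [bO|bO] := boolP (b \in O).
  apply: (step O (fun e => a (e b) (v e)) 0%N) => //.
  - move=> c cO e i; rewrite upd_neq ?dep //; by apply: contraNneq cO => <-.
  - move=> c cO; have [->//|cb] := eqVneq c b; exact: sub'.
  - by move=> c cO cw; apply: cnt' => //; apply: contraNneq cO => ->.
  - by rewrite /= bw.
  - by rewrite mul1r middle_bound.
apply: (step (b |: O) (fun e => a (e b) (v e)) 1%N) => //.
- move=> c; rewrite !inE negb_or => /andP[cb cO] e i; rewrite upd_neq ?dep //.
  by rewrite eq_sym.
- by move=> c; rewrite !inE => /orP[/eqP->//|cO]; apply: sub' => //; apply: contraNneq bO => <-.
- by move=> c; rewrite !inE negb_or => /andP[cb cO] cw; apply: cnt'.
- rewrite /= bw addnCA; congr (_ + _)%N.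
  have b_undup : b \in undup w by rewrite mem_undup.
  rewrite !(seq.permP (perm_to_rem b_undup)) /= bO !inE eqxx /= add0n; congr (_.+1).
  apply: eq_in_count => c; rewrite mem_rem_uniq ?undup_uniq // !inE => /andP[cb _].
  by rewrite (negPf cb).
rewrite expr1 (open_bound bO dep) mulr_sumr.
by apply: ler_sum => e _; apply: q_le.
Qed.

(** The first letter is absorbed into [q x] and the last into [q y], which leaves [(size w).-2]
    factors [rho2]. Every label opens once and closes once, so the powers of [n] cancel. *)
Lemma word_bound_cst w x y :
    w != [::] -> (forall b, (1 < count_mem b w)%N) ->
  `|\sum_e dot (act e w x) y| ^+ 2 <= rho2 ^+ (size w).-2 * (q x * q y).
Proof.
case: w => // b w _ cnt.
have in_w c : c \in w.
  have := cnt c; rewrite /= -has_pred1 has_count; case: (b == c) => //.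
  by move=> /ltnW.
have w_neq0 : w != [::] by apply: contraTneq (in_w b) => ->.
have dep : depends_on [set b] (fun e => a (e b) x).
  by move=> c; rewrite inE => cb e i; rewrite upd_neq // eq_sym.
have := word_bound y w_neq0 dep (fun c _ => in_w c).
have undup_size : size (undup w) = #|B|.
  rewrite -(card_uniqP (undup_uniq w)); apply: eq_card => c.
  by rewrite mem_undup in_w.
have B_gt0 : (0 < #|B|)%N by apply/card_gt0P; exists b.
have count_undup : count [predC [set b]] (undup w) = #|B|.-1.
  have b_undup : b \in undup w by rewrite mem_undup.
  rewrite -undup_size (perm_size (perm_to_rem b_undup)) /=.
  rewrite (seq.permP (perm_to_rem b_undup)) /= !inE eqxx add0n.
  rewrite -[RHS]count_predT; apply: eq_in_count => c.
  by rewrite mem_rem_uniq ?undup_uniq // !inE => /andP[->].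
rewrite undup_size count_undup => bound.
have sqn : n * sqnorm (fun e => a (e b) x) = n ^+ #|B| * q x.
  rewrite (@open_bound b finset.set0 (fun=> x)) ?inE //.
  by rewrite sumr_const card_ffun -mulr_natl natrX.
have cnt' c : c \notin [set b] -> c \in w -> (1 < count_mem c w)%N.
  by rewrite inE eq_sym => /negPf cb _; have := cnt c; rewrite /= cb.
rewrite -(ler_pM2l (exprn_gt0 (#|B| + #|B|) n_gt0)).
have := ler_wpM2l (ltW n_gt0) (bound cnt').
rewrite [X in X <= _ -> _]mulrA -exprS -addnS prednK // => /le_trans; apply.
rewrite mulrCA exprD -[leRHS]mulrA ler_wpM2l ?exprn_ge0 ?(ltW n_gt0) //.
rewrite mulrCA sqn [X in X <= _]mulrCA (mulrC (q x)) -!mulrA; exact: lexx.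
Qed.

Hypothesis a_sum0 : forall x, \sum_i a i x = 0.

(** Summing over the value of [b] alone places [\sum_i a i = 0] at its unique occurrence. *)
Lemma word_sum_eq0 b w x : count_mem b w = 1%N -> \sum_e act e w x = 0.
Proof.
move=> cnt; have bw : b \in w by rewrite -has_pred1 has_count cnt.
case/splitPr: bw cnt => w1 w2; rewrite count_cat /= eqxx addnCA add1n => -[] /eqP.
rewrite addn_eq0 => /andP[/eqP w1b /eqP w2b].
have bw1 : b \notin w1 by rewrite -has_pred1 has_count w1b.
have bw2 : b \notin w2 by rewrite -has_pred1 has_count w2b.
apply: (@scalerI _ _ n) => //; rewrite scaler0 scaler_nat.
rewrite -(sum_upd (fun e => act e _ x) b) big1 // => e _.
have actE i : act (upd e b i) (w1 ++ b :: w2) x = act e w2 (a i (act e w1 x)).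
  rewrite /act foldl_cat /= -/(act _ w1 x) upd_eq -/(act _ w2 _).
  by rewrite !act_upd.
under eq_bigr do rewrite actE.
by rewrite -linear_sum a_sum0 linear0.
Qed.

Lemma word_sum_le rho w x :
    rho2 = rho ^+ 2 -> 0 <= rho -> w != [::] -> (forall b, b \in w) ->
  `|dot (\sum_e act e w x) x| <= rho ^+ (size w).-2 * q x.
Proof.
move=> rho2E rho_ge0 w_neq0 in_w.
have rhs_ge0 : 0 <= rho ^+ (size w).-2 * q x by rewrite mulr_ge0 ?exprn_ge0.
have [cnt|] := boolP [forall b, (1 < count_mem b w)%N]; last first.
  rewrite negb_forall => /existsP[b cnt].
  rewrite (@word_sum_eq0 b) ?linear0l ?normr0 //.
  by apply/eqP; rewrite eqn_leq leqNgt cnt -has_count has_pred1 in_w.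
rewrite -(ler_pXn2r (n := 2)) ?nnegrE // linear_sumlz.
apply: le_trans (word_bound_cst x x w_neq0 (forallP cnt)) _.
by rewrite rho2E -exprM mulnC exprM exprMn -expr2.
Qed.

End LabelledWords.

(** * Injectivity as a determinant, and the resulting bound on [E_k] *)

Section DistinctSums.
Variables (C : numClosedFieldType) (V : lmodType C) (dot : {dot V for Num.conj}).
Variables (I : finType) (a : I -> {linear V -> V}).

Definition distinct_sum (k : nat) (x : V) : V :=
  \sum_(j : {ffun 'I_k -> I} | injectiveb j)
    (\big[comp/idfun]_(p < k) (a (j p) : V -> V)) x.

(** The matrix is the identity if [j] is injective; otherwise two of its rows agree. *)
Lemma det_coincidence (R : comNzRingType) k (j : {ffun 'I_k -> I}) :
  \det (\matrix_(p, r) (j p == j r)%:R) = (injectiveb j)%:R :> R.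
Proof.
have [/injectiveP inj|] := boolP (injectiveb j).
  rewrite (_ : \matrix_(p, r) _ = 1%:M) ?det1 //.
  by apply/matrixP => p r; rewrite !mxE (inj_eq inj).
case/injectivePn => p [r pr jpr]; apply: (determinant_alternate pr) => s.
by rewrite !mxE jpr.
Qed.

Lemma injective_perm_sum (R : comNzRingType) k (j : {ffun 'I_k -> I}) :
  (injectiveb j)%:R =
  \sum_(s : 'S_k) (-1) ^+ s * [forall p, j p == j (s p)]%:R :> R.
Proof.
rewrite -det_coincidence; apply: eq_bigr => s _; congr (_ * _).
under eq_bigr do rewrite mxE.
have [/forallP fix_s|] := boolP [forall p, j p == j (s p)].
  by rewrite big1 // => p _; rewrite fix_s.
by rewrite negb_forall => /existsP[p /negPf jp]; rewrite (bigD1 p) //= jp mul0r.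
Qed.

Lemma distinct_sum_perm k x :
  distinct_sum k x =
  \sum_(s : 'S_k) (-1) ^+ s *:
     \sum_(j : {ffun 'I_k -> I} | [forall p, j p == j (s p)])
       (\big[comp/idfun]_(p < k) (a (j p) : V -> V)) x.
Proof.
under eq_bigr do rewrite scaler_sumr big_mkcond.
rewrite exchange_big /distinct_sum big_mkcond /=; apply: eq_bigr => j _.
set y := (\big[_/_]_(p < k) _) x.
transitivity ((injectiveb j)%:R *: y : V).
  by case: injectiveb; rewrite ?scale1r ?scale0r.
rewrite (injective_perm_sum C) scaler_suml; apply: eq_bigr => s _.
by case: [forall p, _]; rewrite ?mulr1 ?mulr0 ?scale0r.
Qed.

Lemma big_compE (J : Type) (f : J -> V -> V) (r : seq J) x :
  (\big[comp/idfun]_(i <- r) f i) x = foldr f x r.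
Proof. by elim: r => [|i r IH]; rewrite ?big_nil ?big_cons //= IH. Qed.

Section Cycles.
Variables (k : nat) (s : 'S_k).

Local Notation cycle_label := {X : {set 'I_k} | X \in porbits s}.

Lemma porbit_in_porbits (p : 'I_k) : porbit s p \in porbits s.
Proof. by apply/imsetP; exists p. Qed.

Definition label_of (p : 'I_k) : cycle_label :=
  exist _ (porbit s p) (porbit_in_porbits p).

Lemma label_ofP p r : reflect (label_of p = label_of r) (p \in porbit s r).
Proof. by rewrite -eq_porbit_mem; apply: (iffP eqP) => [?|/(congr1 val)//]; apply: val_inj. Qed.

Lemma label_of_perm p : label_of (s p) = label_of p.
Proof. by apply/label_ofP; rewrite -{1}(expg1 s) mem_porbit. Qed.

Lemma label_of_surj (X : cycle_label) : exists p, label_of p == X.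
Proof. by case: X => X /= XP; have /imsetP[p _ Xp] := XP; exists p; apply/eqP/val_inj. Qed.

Definition label_repr X : 'I_k := xchoose (label_of_surj X).

Lemma label_reprK : cancel label_repr label_of.
Proof. by move=> X; apply/eqP/(xchooseP (label_of_surj X)). Qed.

(** Functions constant on the cycles of [s] are functions of the cycle, and the cycles serve as
    labels. The reversal is due to the last factor of a composition acting first. *)
Lemma cycle_sum_words x :
  \sum_(j : {ffun 'I_k -> I} | [forall p, j p == j (s p)])
     (\big[comp/idfun]_(p < k) (a (j p) : V -> V)) x =
  \sum_(e : {ffun cycle_label -> I})
     act a e (rev [seq label_of p | p <- enum 'I_k]) x.
Proof.
rewrite (reindex_onto (fun e : {ffun cycle_label -> I} => [ffun p => e (label_of p)])
   (fun j => [ffun X => j (label_repr X)])) /=; last first.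
  move=> j /forallP inv; apply/ffunP => p; rewrite !ffunE.
  have /label_ofP/porbitP[m ->] := label_reprK (label_of p).
  elim: m => [|m IH]; first by rewrite expg0 perm1.
  by rewrite expgSr permM -(eqP (inv _)).
apply: eq_big => [e|e _].
  apply/andP; split.
    by apply/forallP => p; rewrite !ffunE label_of_perm.
  by apply/eqP/ffunP => X; rewrite !ffunE label_reprK.
have -> : enum 'I_k = index_enum 'I_k by rewrite enumT /index_enum unlock.
rewrite big_compE /act foldl_rev foldr_map.
by elim: (index_enum 'I_k) => //= p r ->; rewrite ffunE.
Qed.

End Cycles.

Hypothesis I_gt0 : (0 < #|I|)%N.
Hypothesis a_selfadj : forall i x y, dot (a i x) y = dot x (a i y).
Hypothesis a_sum0 : forall x, \sum_i a i x = 0.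
Variable rho : C.
Hypothesis rho_ge0 : 0 <= rho.
Hypothesis square_sum_le :
  forall x, \sum_i dot (a i x) (a i x) <= rho ^+ 2 * dot x x.

Lemma distinct_sum_le k x : (0 < k)%N ->
  `|dot (distinct_sum k x) x| <=
    k`!%:R * rho ^+ k.-2 * \sum_i dot (a i x) (a i x).
Proof.
move=> k_gt0; rewrite distinct_sum_perm linear_sumlz.
apply: le_trans (ler_norm_sum _ _ _) _.
rewrite -card_Sn -mulrA mulr_natl -sumr_const; apply: ler_sum => s _.
rewrite linearZl_LR normrM normrX normrN1 expr1n mul1r cycle_sum_words.
set w := rev _; have size_w : size w = k by rewrite size_rev size_map size_enum_ord.
rewrite -[in rho ^+ _]size_w.
apply: (@word_sum_le _ _ _ _ _ _ I_gt0 a_selfadj (rho ^+ 2)) => //.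
- exact: exprn_ge0.
- by rewrite -size_eq0 size_w -lt0n.
- move=> X; rewrite mem_rev; apply/mapP; exists (label_repr X); first by rewrite mem_enum.
  by rewrite label_reprK.
Qed.

End DistinctSums.

(** * Square roots of positive operators *)

Section Majorant.
Variable F : numFieldType.

Fixpoint sqrt_majorant (k : nat) : F :=
  if k is k'.+1 then (1 + sqrt_majorant k' ^+ 2) / 2 else 0.

Lemma sqrt_majorant_bounds k : 0 <= sqrt_majorant k <= 1.
Proof.
elim: k => [|k /andP[ge0 le1]] /=; first by rewrite lexx ler01.
rewrite divr_ge0 ?addr_ge0 ?exprn_ge0 //= ler_pdivrMr ?ltr0n // mul1r.
by rewrite -[2]/(1 + 1) lerD2l expr_le1.
Qed.

Lemma sqrt_majorant_ge0 k : 0 <= sqrt_majorant k.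
Proof. by case/andP: (sqrt_majorant_bounds k). Qed.

Lemma sqrt_majorant_le1 k : sqrt_majorant k <= 1.
Proof. by case/andP: (sqrt_majorant_bounds k). Qed.

(** The gap [d] to the fixed point 1 follows the recursion [d - d ^+ 2 / 2], hence decays like
    [2 / k]. *)
Lemma sqrt_majorant_rate k : 1 - sqrt_majorant k <= 2 / k.+1%:R.
Proof.
rewrite ler_pdivlMr ?ltr0n //.
elim: k => [|k IH]; first by rewrite /= subr0 mul1r -[2]/(1 + 1) lerDl ler01.
move: IH (sqrt_majorant_le1 k) (sqrt_majorant_ge0 k); rewrite /=.
set c := sqrt_majorant k; rewrite -[k.+2%:R]natr1 -[k.+1%:R]natr1 => IH c_le1 c_ge0.
pose d := 1 - c; have d_ge0 : 0 <= d by rewrite subr_ge0.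
have d_le1 : d <= 1 by rewrite gerBl.
rewrite (_ : 1 - _ = d - d ^+ 2 / 2); last by rewrite /d; field.
move: IH; rewrite -/d; set m : F := k%:R => IH.
have m_ge0 : 0 <= m by apply: ler0n.
(* A decomposition into terms that are nonnegative by the induction hypothesis and [d <= 1]. *)
rewrite -subr_ge0 (_ : _ - _ = (2 - d * (m + 1)) / 2 +
  (2 - d * (m + 1)) / 2 * (1 - d) + d ^+ 2 / 2); last by field.
have ? : 0 <= 2 - d * (m + 1) by rewrite subr_ge0.
have ? : 0 <= 1 - d by rewrite subr_ge0.
have ? : (0 : F) <= 2^-1 by rewrite invr_ge0 ler0n.
by apply: addr_ge0; [apply: addr_ge0|]; rewrite ?mulr_ge0 ?exprn_ge0.
Qed.

End Majorant.

Section HilbertSpace.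
Variables (R : realType) (H : completeNormedModType R[i]).
Local Notation C := R[i].
Implicit Types x y : H.

Lemma archimedean_complex (M e : C) : 0 <= M -> 0 < e -> exists k, M / k.+1%:R < e.
Proof.
move=> M_ge0 e_gt0; exists (Num.truncn (complex.Re M / complex.Re e)).
set k := Num.truncn _.
have M_real : M = ((complex.Re M)%:C)%C by rewrite RRe_real // ger0_real.
have e_real : e = ((complex.Re e)%:C)%C by rewrite RRe_real // gtr0_real.
have Re_e_gt0 : 0 < complex.Re e by move: e_gt0; rewrite {1}e_real ltcR.
rewrite ltr_pdivrMr ?ltr0n // M_real e_real.
rewrite (_ : k.+1%:R = ((k.+1%:R : R)%:C)%C); last by rewrite rmorph_nat.
by rewrite -rmorphM /= ltcR mulrC -ltr_pdivrMr // truncnS_gt.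
Qed.

(** Identities for the limit of the iteration are obtained from explicit [1 / k] error bounds
    through this criterion. *)
Lemma eq_of_rate (V : normedModType C) (u v : V) (M : C) :
  (forall k, `|u - v| <= M / k.+1%:R) -> u = v.
Proof.
move=> rate; apply/eqP; rewrite -subr_eq0 -normr_eq0; apply/negPn/negP => neq0.
have gt0 : 0 < `|u - v| by rewrite lt_def neq0 normr_ge0.
have M_ge0 : 0 <= M by have := rate 0%N; rewrite divr1; apply: le_trans.
have [k] := archimedean_complex M_ge0 gt0.
by move=> /(le_lt_trans (rate k)); rewrite ltxx.
Qed.

(** * Convergence of the square root iteration *)

Section SquareRootIteration.
Variable B : {linear H -> H}.
Hypothesis B_contraction : forall x, `|B x| <= `|x|.

(* Iterating [Y = (B + Y o Y) / 2] converges to [1 - sqrt (1 - B)]; the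
   same recursion with [B] replaced by the scalar [1] is [sqrt_majorant]. *)
Fixpoint sqrt_iter (k : nat) (x : H) : H :=
  if k is k'.+1 then 2^-1 *: (B x + sqrt_iter k' (sqrt_iter k' x)) else 0.

Let c : nat -> C := @sqrt_majorant C.

Lemma sqrt_iter_linear k : linear (sqrt_iter k).
Proof.
elim: k => [|k IH] a x y /=; first by rewrite scaler0 addr0.
rewrite linearP !IH addrACA -scalerDr [2^-1 *: (a *: _ + _)]scalerDr.
by rewrite !scalerA (mulrC a).
Qed.
HB.instance Definition _ k := GRing.isLinear.Build C H H _ (sqrt_iter k) (sqrt_iter_linear k).

Lemma sqrt_iter_norm k x : `|sqrt_iter k x| <= c k * `|x|.
Proof.
elim: k x => [|k IH] x /=; first by rewrite normr0 mul0r.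
rewrite normrZ normfV normr_nat /c /= mulrAC mulrC ler_wpM2r ?invr_ge0 //.
rewrite mulrDl mul1r (le_trans (ler_normD _ _)) // lerD //.
apply: le_trans (IH _) _; rewrite expr2 -mulrA ler_wpM2l ?IH //.
exact: sqrt_majorant_ge0.
Qed.

(** With [Y] the iterates, split [Y_(k+1)^2 - Y_k^2] as [Y_(k+1) (Y_(k+1) - Y_k) + (Y_(k+1) - Y_k)
    Y_k]; the majorant satisfies the same recursion with equality. *)
Lemma sqrt_iter_step k x :
  `|sqrt_iter k.+1 x - sqrt_iter k x| <= (c k.+1 - c k) * `|x|.
Proof.
elim: k x => [|k IH] x.
  have := sqrt_iter_norm 1 x; rewrite /c /= !subr0; exact.
have -> : sqrt_iter k.+2 x - sqrt_iter k.+1 x =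
    2^-1 *: (sqrt_iter k.+1 (sqrt_iter k.+1 x - sqrt_iter k x) +
      (sqrt_iter k.+1 (sqrt_iter k x) - sqrt_iter k (sqrt_iter k x))).
  rewrite linearB /= -scalerBr; congr (_ *: _).
  by rewrite opprD addrACA subrr add0r addrA subrK.
have -> : (c k.+2 - c k.+1) * `|x| =
    2^-1 * (c k.+1 * ((c k.+1 - c k) * `|x|) + (c k.+1 - c k) * (c k * `|x|)).
  have -> : c k.+2 - c k.+1 = (c k.+1 ^+ 2 - c k ^+ 2) / 2.
    by rewrite /c /=; field.
  by field.
rewrite normrZ normfV normr_nat ler_wpM2l ?invr_ge0 //.
rewrite (le_trans (ler_normD _ _)) // lerD //.
  apply: le_trans (sqrt_iter_norm _ _) _.
  by rewrite ler_wpM2l ?IH ?sqrt_majorant_ge0.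
apply: le_trans (IH _) _; rewrite ler_wpM2l ?sqrt_iter_norm //.
rewrite /c /= -/(c k) (_ : _ - _ = (1 - c k) ^+ 2 / 2); last by field.
by rewrite divr_ge0 ?exprn_ge0 ?subr_ge0 ?sqrt_majorant_le1.
Qed.

Lemma sqrt_iter_dist k m x : (k <= m)%N ->
  `|sqrt_iter m x - sqrt_iter k x| <= (1 - c k) * `|x|.
Proof.
move=> /subnK <-; move: (m - k)%N => {}m.
apply: (@le_trans _ _ ((c (m + k)%N - c k) * `|x|)); last first.
  by rewrite ler_wpM2r // lerD2r sqrt_majorant_le1.
elim: m => [|m IH]; first by rewrite add0n !subrr normr0 mul0r.
rewrite addSn -(subrKA (sqrt_iter (m + k) x)) -(subrKA (c (m + k)%N)) mulrDl.
by rewrite (le_trans (ler_normD _ _)) // lerD // sqrt_iter_step.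
Qed.

Lemma sqrt_iter_lim x :
  exists l : H, forall k, `|l - sqrt_iter k x| <= (1 - c k) * `|x|.
Proof.
have : cauchy (sqrt_iter^~ x @ \oo)%classic.
  apply/cauchyP => e e_gt0.
  have [|k lt_e] := @archimedean_complex (2 * `|x|) e _ e_gt0.
    by rewrite mulr_ge0.
  exists (sqrt_iter k x).
  suff : (\forall m \near \oo, ball (sqrt_iter k x) e (sqrt_iter m x))%classic by [].
  near=> m; rewrite -ball_normE /= distrC.
  apply: le_lt_trans lt_e; apply: le_trans (@sqrt_iter_dist k m x _) _.
    by near: m; exact: nbhs_infty_ge.
  by rewrite mulrAC ler_wpM2r // sqrt_majorant_rate.
move=> /cauchy_cvg /cvg_ex[l l_lim]; exists l => k.
apply/ler_addgt0Pr => e e_gt0.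
have /cvgrPdist_lt /(_ _ e_gt0) dist_e := l_lim.
near \oo%classic => m.
rewrite -(subrKA (sqrt_iter m x)) addrC (le_trans (ler_normD _ _)) // lerD //.
  by apply: sqrt_iter_dist; near: m; exact: nbhs_infty_ge.
by apply: ltW; near: m.
Unshelve. all: by end_near. Qed.

(** The limit is selected by its error bound, which determines it because [1 - c k] tends to 0;
    [sqrt_iter_lim] rules out the default value. *)
Definition sqrt_iter_limit (x : H) : H := xget 0
  [set l | forall k, `|l - sqrt_iter k x| <= (1 - c k) * `|x|]%classic.

Lemma sqrt_iter_limitP x k :
  `|sqrt_iter_limit x - sqrt_iter k x| <= (1 - c k) * `|x|.
Proof.
have [l lP] := sqrt_iter_lim x.
by rewrite /sqrt_iter_limit; case: xgetP => [l' _ /(_ k) // | /(_ l)]; case.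
Qed.

Lemma sqrt_iter_limit_rate x k :
  `|sqrt_iter_limit x - sqrt_iter k x| <= 2 / k.+1%:R * `|x|.
Proof.
apply: le_trans (sqrt_iter_limitP x k) _.
by rewrite ler_wpM2r // sqrt_majorant_rate.
Qed.

Lemma sqrt_iter_limit_contraction x : `|sqrt_iter_limit x| <= `|x|.
Proof. by have := sqrt_iter_limitP x 0; rewrite /c /= !subr0 mul1r. Qed.

Lemma sqrt_iter_limit_linear : linear sqrt_iter_limit.
Proof.
move=> a x y; set L := sqrt_iter_limit.
apply: (@eq_of_rate _ _ _ (2 * `|a *: x + y| + `|a| * (2 * `|x|) + 2 * `|y|)) => k.
have -> : L (a *: x + y) - (a *: L x + L y) =
    (L (a *: x + y) - sqrt_iter k (a *: x + y)) -
    a *: (L x - sqrt_iter k x) - (L y - sqrt_iter k y).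
  rewrite [sqrt_iter k (_ + _)]linearP scalerBr -[RHS]addrA -opprD.
  by rewrite [X in _ = _ - X]addrACA -opprD opprB subrKA.
rewrite (le_trans (ler_normB _ _)) // 2!mulrDl lerD //; last first.
  by rewrite mulrAC sqrt_iter_limit_rate.
rewrite (le_trans (ler_normB _ _)) // lerD //.
  by rewrite mulrAC sqrt_iter_limit_rate.
by rewrite normrZ -mulrA ler_wpM2l // mulrAC sqrt_iter_limit_rate.
Qed.

(** For [L] the limit this reads [(1 - L)^2 = 1 - B], the source of the square root. *)
Lemma sqrt_iter_limit_fixpoint x :
  2 *: sqrt_iter_limit x = B x + sqrt_iter_limit (sqrt_iter_limit x).
Proof.
set L := sqrt_iter_limit.
apply: (@eq_of_rate _ _ _ (2 * (2 * `|x|) + (2 * `|L x| + 2 * `|x|))) => k.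
have -> : 2 *: L x - (B x + L (L x)) = 2 *: (L x - sqrt_iter k.+1 x) -
    ((L (L x) - sqrt_iter k (L x)) + sqrt_iter k (L x - sqrt_iter k x)).
  rewrite [sqrt_iter k (_ - _)]linearB [sqrt_iter k.+1 x]/= scalerBr scalerA.
  rewrite divff ?pnatr_eq0 // scale1r subrKA !(addrC (B x)) -[RHS]addrA -opprD.
  by rewrite [X in _ = _ - X]addrC subrKA.
rewrite (le_trans (ler_normB _ _)) // mulrDl lerD //.
  rewrite normrZ normr_nat -mulrA ler_wpM2l //.
  apply: le_trans (sqrt_iter_limit_rate x k.+1) _.
  rewrite mulrAC ler_wpM2l ?mulr_ge0 //.
  by rewrite lef_pV2 ?posrE ?ltr0n // ler_nat.
rewrite (le_trans (ler_normD _ _)) // mulrDl lerD //.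
  by rewrite mulrAC sqrt_iter_limit_rate.
apply: le_trans (sqrt_iter_norm _ _) _.
apply: (@le_trans _ _ (1 * (2 / k.+1%:R * `|x|))); last by rewrite mul1r mulrAC.
by rewrite ler_pM ?sqrt_majorant_ge0 ?sqrt_majorant_le1 ?sqrt_iter_limit_rate.
Qed.

Variable dot : {dot H for (@Num.conj R[i])}.
Hypothesis hdot : hilbert_dot dot.
Hypothesis B_selfadj : selfadjoint dot B.

Lemma dot_norm_le x y : `|dot x y| <= `|x| * `|y|.
Proof.
rewrite -(ler_pXn2r (n := 2)) ?nnegrE ?mulr_ge0 // exprMn !hdot.
by have := @sum_dot_CauchySchwarz _ _ dot 'I_1 (fun=> x) (fun=> y); rewrite !big_ord1.
Qed.

Lemma sqrt_iter_selfadj k : selfadjoint dot (sqrt_iter k).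
Proof.
elim: k => [|k IH] x y /=; first by rewrite linear0l linear0r.
rewrite linearZl_LR linearZr_LR /= linearDl linearDr /= B_selfadj !IH.
by rewrite fmorphV rmorph_nat [dot x (_ + _)]linearDr mulrDr.
Qed.

Lemma sqrt_iter_limit_selfadj : selfadjoint dot sqrt_iter_limit.
Proof.
move=> x y; set L := sqrt_iter_limit.
apply: (@eq_of_rate C^o _ _ (2 * `|x| * `|y| + 2 * `|x| * `|y|)) => k.
have -> : dot (L x) y - dot x (L y) =
    dot (L x - sqrt_iter k x) y - dot x (L y - sqrt_iter k y).
  by rewrite linearBl linearBr /= sqrt_iter_selfadj opprB addrA subrK.
rewrite (le_trans (ler_normB _ _)) // mulrDl lerD //.
  apply: le_trans (dot_norm_le _ _) _.
  by rewrite mulrAC ler_wpM2r // mulrAC sqrt_iter_limit_rate.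
apply: le_trans (dot_norm_le _ _) _.
by rewrite (mulrC 2) -!mulrA ler_wpM2l // (mulrC `|y|) mulrA sqrt_iter_limit_rate.
Qed.

End SquareRootIteration.

Variable dot : {dot H for (@Num.conj R[i])}.
Hypothesis hdot : hilbert_dot dot.

(** Polarization: a nonnegative quadratic form is real, and its values at [x + y] and [x + 'i *: y]
    determine the sum and the difference of [p^*] and [r^*]. *)
Lemma psd_selfadjoint (T : {linear H -> H}) : psd dot T -> selfadjoint dot T.
Proof.
move=> T_psd; pose f x y := dot (T x) y.
have f_real x : (f x x)^* = f x x by rewrite geC0_conj // T_psd.
have fDD a x y : f (x + a *: y) (x + a *: y) =
    f x x + a^* * f x y + a * f y x + a * a^* * f y y.
  rewrite /f [T _]linearD [T (_ *: _)]linearZ /= dotDl !dotDr !dotZl !dotZr.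
  by rewrite !mulrA !addrA.
suff fC x y : f y x = (f x y)^* by move=> x y; rewrite -/(f x y) dotC -/(f y x) -fC.
have := f_real (x + 1 *: y); have := f_real (x + 'i *: y).
rewrite !fDD !(rmorphD, rmorphM) /= !f_real conjCi rmorphN /= conjCi opprK.
rewrite !rmorph1 !mul1r; set p := f x y; set r := f y x => eq_i eq_1.
have eqD : p^* + r^* = p + r.
  apply: (@addrI _ (f x x)); apply: (@addIr _ (f y y)).
  by move: eq_1; rewrite !addrA.
have /(mulfI (neq0Ci _)) eqB : 'i * (p^* - r^*) = 'i * (r - p).
  apply: (@addrI _ (f x x)); apply: (@addIr _ ('i * - 'i * f y y)).
  rewrite !mulrBr ['i * r - _]addrC !addrA -!mulNr [in LHS]mulrN -[in LHS]mulNr.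
  exact: eq_i.
apply: (@mulfI _ 2); first by rewrite pnatr_eq0.
rewrite -[2]/(1 + 1) !mulrDl !mul1r.
have -> : p^* + p^* = (p^* - r^*) + (p^* + r^*) by rewrite addrCA subrK.
by rewrite eqB eqD subrKA.
Qed.

(** Cauchy-Schwarz for the form [dot (B u) v] at [x] and [B x] gives [dot (B x) (B x) ^+ 2 <= dot x
    x * dot (B x) (B x)]. *)
Lemma psd_contraction (B : {linear H -> H}) :
  psd dot B -> (forall x, dot (B x) x <= dot x x) -> forall x, `|B x| <= `|x|.
Proof.
move=> B_psd B_le x.
have B_sa := psd_selfadjoint B_psd.
have [->|Bx_neq0] := eqVneq (B x) 0; first by rewrite normr0.
have Bx_gt0 : 0 < dot (B x) (B x) by rewrite dnorm_gt0.
rewrite -(ler_pXn2r (n := 2)) ?nnegrE // !hdot -(ler_pM2r Bx_gt0) -expr2.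
rewrite -{1}(ger0_norm (ltW Bx_gt0)).
have := @psd_form_CauchySchwarz _ _ (fun u v => dot (B u) v) x (B x).
move=> /(_ _ _ _ _)/le_trans; apply => //.
- by move=> u v w; rewrite [B _]linearD dotDl.
- by move=> a u v; rewrite [B _]linearZ dotZl.
- by move=> u v; rewrite B_sa dotC.
- by rewrite ler_pM ?B_le ?B_psd.
Qed.

(** Rescale so that [B = 1 - T / r^2] lies between 0 and 1; if [L] is the limit of the iteration for
    [B], then [r (1 - L)] squares to [r^2 (1 - B) = T]. *)
Lemma psd_has_sqrt (T : {linear H -> H}) :
  bounded_op T -> psd dot T -> exists S, is_op_sqrt dot T S.
Proof.
move=> [_ [M T_le]] T_psd.
(* The bound [M] may be zero or negative; this choice ensures both [0 < r] and [M <= r ^+ 2]. *)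
pose r : C := ((Num.sqrt (`|M| + 1))%:C)%C.
have r_gt0 : 0 < r by rewrite ltcR sqrtr_gt0 ltr_wpDl.
have r_neq0 := lt0r_neq0 r_gt0.
have M_le : (M%:C)%C <= r ^+ 2.
  rewrite -rmorphXn /= lecR sqr_sqrtr ?addr_ge0 //.
  by rewrite (le_trans (ler_norm M)) // lerDl.
pose B0 (x : H) := x - r ^- 2 *: T x.
have B0_linear : linear B0.
  move=> a x y; rewrite /B0 [T _]linearP !scalerDr opprD addrACA scalerN.
  by rewrite !scalerA (mulrC a).
pose B : {linear H -> H} :=
  HB.pack B0 (GRing.isLinear.Build C H H _ B0 B0_linear).
have r2_ge0 : 0 <= r ^- 2 by rewrite invr_ge0 exprn_ge0 // ltW.
have dotB x : dot (B x) x = dot x x - r ^- 2 * dot (T x) x.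
  by rewrite /B /= /B0 dotDl -scaleNr dotZl mulNr.
have B_psd : psd dot B.
  move=> x; rewrite dotB subr_ge0 mulrC ler_pdivrMr ?exprn_gt0 //.
  rewrite -(ger0_norm (T_psd x)) (le_trans (dot_norm_le hdot _ _)) //.
  rewrite -hdot expr2 mulrAC ler_wpM2r // (le_trans (T_le _)) // mulrC.
  by rewrite ler_wpM2l.
have B_le x : dot (B x) x <= dot x x.
  by rewrite dotB gerBl mulr_ge0 // T_psd.
have B_contr := psd_contraction B_psd B_le.
have B_sa := psd_selfadjoint B_psd.
pose L := sqrt_iter_limit B.
have L_sa : selfadjoint dot L by apply: sqrt_iter_limit_selfadj.
have L_linear : linear L by apply: sqrt_iter_limit_linear.
have L_contr x : `|L x| <= `|x| by apply: sqrt_iter_limit_contraction.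
have S_linear : linear (fun x => r *: (x - L x)).
  move=> a x y; rewrite L_linear opprD addrACA -scalerBr scalerDr !scalerA.
  by rewrite (mulrC a).
exists (fun x => r *: (x - L x)); split.
- split=> //; exists (Num.sqrt (`|M| + 1) * 2) => x.
  rewrite normrZ gtr0_norm // rmorphM /= -mulrA ler_wpM2l ?(ltW r_gt0) //.
  rewrite (le_trans (ler_normB _ _)) // rmorph_nat mulrDl mul1r lerD2l.
  exact: L_contr.
- move=> x; rewrite dotZl mulr_ge0 ?(ltW r_gt0) // dotDl -scaleN1r dotZl mulN1r subr_ge0.
  have Lx_real : dot (L x) x \is Num.real by apply/CrealP; rewrite -dotC L_sa.
  apply: le_trans (real_ler_norm Lx_real) _.
  by rewrite (le_trans (dot_norm_le hdot _ _)) // -hdot expr2 ler_wpM2r.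
- apply/funext => x /=.
  have -> : L (r *: (x - L x)) = r *: (L x - L (L x)).
    pose L' : {linear H -> H} := HB.pack L (GRing.isLinear.Build C H H _ L L_linear).
    by transitivity (L' (r *: (x - L x))); rewrite // linearZ [L' (_ - _)]linearB.
  have LL : L (L x) = 2 *: L x - B x.
    by rewrite sqrt_iter_limit_fixpoint // addrC addKr.
  rewrite -scalerBr scalerA -expr2 LL scaler_nat mulr2n opprB.
  rewrite [_ - B x - L x]addrAC addrK subrKA /B /= /B0 opprB addrC subrK.
  by rewrite scalerA divff ?scale1r // expf_neq0.
Qed.

Lemma op_norm_le (S : {linear H -> H}) x :
  bounded_op S -> `|S x| <= ((op_norm S)%:C)%C * `|x|.
Proof.
move=> [_ [M S_le]].
have [->|x_neq0] := eqVneq x 0; first by rewrite linear0 !normr0 mulr0.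
have x_gt0 : 0 < `|x| by rewrite normr_gt0.
rewrite -ler_pdivrMr // -[leLHS]RRe_real; last by rewrite ger0_real // divr_ge0.
rewrite lecR; apply: sup_upper_bound; last first.
  exists (`|x|^-1 *: x) => /=; first by rewrite normrZ normfV normr_id mulVf // normr_eq0.
  by rewrite linearZ normrZ normfV normr_id mulrC.
split; first by exists (complex.Re `|S 0|), 0 => //=; rewrite normr0 ler01.
exists `|M| => _ [y /= y_le1 <-].
rewrite -lecR RRe_real ?ger0_real // (le_trans (S_le y)) //.
apply: (@le_trans _ _ ((`|M|%:C)%C * `|y|)); first by rewrite ler_wpM2r // lecR ler_norm.
by rewrite -[leRHS]mulr1 ler_wpM2l // ler0c.
Qed.

(** Since a square root exists, [S = op_sqrt dot T] is one and not the default 0; then [dot (T x) x]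
    is the square of the norm of [S x]. *)
Lemma dot_psd_le_op_sqrt (T : {linear H -> H}) x :
    bounded_op T -> psd dot T ->
  dot (T x) x <= ((op_norm (op_sqrt dot T))%:C)%C ^+ 2 * dot x x.
Proof.
move=> T_bnd T_psd; have [S0 S0P] := psd_has_sqrt T_bnd T_psd.
have [S_bnd S_psd SS] : is_op_sqrt dot T (op_sqrt dot T).
  by rewrite /op_sqrt; case: xgetP => [S _ //|/(_ S0)]; case.
have [S_linear _] := S_bnd.
pose S : {linear H -> H} :=
  HB.pack (op_sqrt dot T) (GRing.isLinear.Build C H H _ (op_sqrt dot T) S_linear).
have S_sa : selfadjoint dot S := @psd_selfadjoint S S_psd.
have -> : T x = S (S x) by rewrite -SS.
rewrite S_sa -!hdot -exprMn ler_pXn2r ?nnegrE //; first exact: (@op_norm_le S).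
by apply: le_trans (@op_norm_le S x S_bnd).
Qed.

End HilbertSpace.

(** * The coefficients *)

Section Coefficients.
Variable F : numFieldType.

(** The new factor [(d - k) / (n - k)] is at most [d / n] because [d <= n], and [n / (3 d)] turns
    [d / n] into [1 / 3]. *)
Lemma falling_ratio_step (n d k : nat) : (k < d <= n)%N ->
  (d ^_ k.+1)%:R / (n ^_ k.+1)%:R * (n%:R / (3 * d%:R)) <=
  (d ^_ k)%:R / (n ^_ k)%:R / 3 :> F.
Proof.
move=> /andP[kd dn]; have kn := leq_trans kd dn.
have d_gt0 : (0 < d%:R :> F) by rewrite ltr0n (leq_ltn_trans _ kd).
have nk_gt0 : (0 < (n - k)%:R :> F) by rewrite ltr0n subn_gt0.
have nf_gt0 : (0 < (n ^_ k)%:R :> F) by rewrite ltr0n ffact_gt0 ltnW.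
rewrite !ffactnSr !natrM.
rewrite [leLHS](_ : _ = (d ^_ k)%:R / (n ^_ k)%:R / 3 *
    (((d - k)%:R * n%:R) / ((n - k)%:R * d%:R))); last first.
  by field; rewrite !lt0r_neq0.
rewrite ler_piMr ?divr_ge0 // ler_pdivrMr ?mulr_gt0 // mul1r -!natrM ler_nat.
by rewrite !mulnBl (mulnC d) leq_sub2l // leq_mul2l dn orbT.
Qed.

Lemma falling_ratio_le (n d k : nat) : (k.+2 <= d <= n)%N ->
  (d ^_ k.+2)%:R / (n ^_ k.+2)%:R * (n%:R / (3 * d%:R)) ^+ k <=
  (d ^_ 2)%:R / (n ^_ 2)%:R / 3 ^+ k :> F.
Proof.
elim: k => [|k IH] /andP[kd dn]; first by rewrite mulr1 divr1.
rewrite exprS mulrA [3 ^+ _]exprSr [(_ * 3)^-1]invfM [leRHS]mulrA.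
have rho_ge0 : 0 <= (n%:R / (3 * d%:R)) ^+ k :> F by rewrite exprn_ge0 // divr_ge0 ?mulr_ge0.
have step : (k.+2 < d <= n)%N by rewrite kd dn.
apply: le_trans (ler_wpM2r rho_ge0 (falling_ratio_step step)) _.
by rewrite mulrAC ler_wpM2r ?invr_ge0 // IH // (ltnW kd).
Qed.

Lemma sum_inv_pow3_le m : \sum_(0 <= k < m) (3 ^+ k.+1)^-1 <= 2^-1 :> F.
Proof.
have -> : \sum_(0 <= k < m) (3 ^+ k.+1)^-1 = (1 - (3 ^+ m)^-1) / 2 :> F.
  elim: m => [|m IH]; first by rewrite big_geq // invr1 subrr mul0r.
  rewrite big_nat_recr //= IH exprS invfM.
  by field; rewrite expf_neq0 // pnatr_eq0.
by rewrite ler_pdivrMr // mulVf ?pnatr_eq0 // gerBl invr_ge0 exprn_ge0.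
Qed.

(* The coefficient of [distinct_sum k] in [P d (1 + a)]: each of the
   ['C(d, k)] choices of the positions of the factors [a] contributes the
   average [P k a]. *)
Definition subset_weight (n d k : nat) : F :=
  ('C(d, k) * (n - k)`!)%:R / n`!%:R.

Lemma subset_weight_ge0 n d k : 0 <= subset_weight n d k.
Proof. exact: divr_ge0. Qed.

Lemma subset_weight_fact n d k : (k <= n)%N ->
  subset_weight n d k * k`!%:R = (d ^_ k)%:R / (n ^_ k)%:R.
Proof.
move=> kn; rewrite /subset_weight -(ffact_fact kn) -(bin_ffact d) !natrM.
have ? : (n ^_ k)%:R != 0 :> F by rewrite pnatr_eq0 -lt0n ffact_gt0.
have ? : ((n - k)`!)%:R != 0 :> F by rewrite pnatr_eq0 -lt0n fact_gt0.
by field; apply/andP.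
Qed.

(** Here the 3 of hypothesis (ii) is decisive: the tail is at most the falling ratio of order 2
    times [1/3 + 1/9 + ... <= 1/2], and that ratio over [2!] is the weight on the right. *)
Lemma subset_weight_tail n m : (m.+2 <= n)%N ->
  \sum_(0 <= k < m) subset_weight n m.+2 k.+3 *
      (k.+3`!%:R * (n%:R / (3 * m.+2%:R)) ^+ k.+1) <=
  subset_weight n m.+2 2.
Proof.
move=> mn; have -> : subset_weight n m.+2 2 =
    (m.+2 ^_ 2)%:R / (n ^_ 2)%:R * 2^-1.
  rewrite -subset_weight_fact; last exact: leq_trans mn.
  by rewrite mulfK // pnatr_eq0.
apply: (@le_trans _ _ (\sum_(0 <= k < m)
    (m.+2 ^_ 2)%:R / (n ^_ 2)%:R * (3 ^+ k.+1)^-1)); last first.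
  by rewrite -mulr_sumr ler_wpM2l ?divr_ge0 ?sum_inv_pow3_le.
rewrite big_nat_cond [leRHS]big_nat_cond; apply: ler_sum => k /andP[/andP[_ km] _].
rewrite mulrA subset_weight_fact; last by apply: leq_trans mn; rewrite !ltnS.
by apply: falling_ratio_le; rewrite !ltnS km.
Qed.

End Coefficients.

(** * The inequality *)

Section Products.
Variables (R : realType) (H : completeNormedModType R[i]).
Local Notation C := R[i].
Implicit Types x y : H.

HB.instance Definition _ :=
  Monoid.isLaw.Build (H -> H) idfun comp (fun _ _ _ => erefl) (fun _ => erefl) (fun _ => erefl).

Variable dot : {dot H for (@Num.conj R[i])}.

Lemma selfadjoint_comp_rev d (g : 'I_d -> H -> H) x y :
    (forall k, selfadjoint dot (g k)) ->
  dot ((\big[comp/idfun]_(k < d) g k) x) y =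
  dot x ((\big[comp/idfun]_(k < d) g (rev_ord k)) y).
Proof.
elim: d g y => [|d IH] g y sa; first by rewrite !big_ord0.
have rev0 : rev_ord ord_max = ord0 :> 'I_d.+1 by apply: val_inj; rewrite /= subnn.
have revS (k : 'I_d) : rev_ord (widen_ord (leqnSn d) k) = lift ord0 (rev_ord k).
  by apply: val_inj; rewrite /= /bump leq0n add1n subSn.
rewrite big_ord_recl big_ord_recr /= sa IH => [|k]; last exact: sa.
by rewrite rev0; under [in RHS]eq_bigr do rewrite revS.
Qed.

(** Adjoints reverse words, and reversal permutes the injective ones. *)
Lemma selfadjoint_P n d (A : 'I_n -> H -> H) :
  (forall i, selfadjoint dot (A i)) -> selfadjoint dot (P d A).
Proof.
move=> sa x y; rewrite /P fct_sumE.
rewrite -[LHS]/(dot (_ *: _) y) -[RHS]/(dot x (_ *: _)) dotZl dotZr.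
congr (_ * _); first by rewrite geC0_conj // divr_ge0.
rewrite linear_sumlz linear_sumr /=.
pose rv (j : {ffun 'I_d -> 'I_n}) := [ffun k => j (rev_ord k)].
have rvK : involutive rv by move=> j; apply/ffunP => k; rewrite !ffunE rev_ordK.
rewrite [RHS](reindex_inj (inv_inj rvK)) /=; apply: eq_big => [j|j _].
  apply/injectiveP/injectiveP => inj k l.
    by rewrite !ffunE => /inj; apply: rev_ord_inj.
  move=> jkl; apply: rev_ord_inj; apply: inj.
  by rewrite !ffunE !rev_ordK.
rewrite selfadjoint_comp_rev //; congr (dot x (_ y)).
by apply: eq_bigr => k _; rewrite ffunE.
Qed.

Lemma P_inj_words n d (f : 'I_n -> {linear H -> H}) x :
  P d (fun i => f i : H -> H) x =
  ((n - d)`!%:R / n`!%:R : C) *: inj_words (fun i => f i) d finset.set0 x.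
Proof.
rewrite -inj_words_ffun /P fct_sumE.
rewrite -[LHS]/(_ *: _); congr (_ *: _); apply: eq_bigl => j.
by rewrite (_ : [forall k, _]) ?andbT //; apply/forallP => k; rewrite inE.
Qed.

Lemma distinct_sum_inj_words n d (f : 'I_n -> {linear H -> H}) x :
  distinct_sum f d x = inj_words (fun i => f i) d finset.set0 x.
Proof.
rewrite -inj_words_ffun /distinct_sum; apply: eq_bigl => j.
by rewrite (_ : [forall k, _]) ?andbT //; apply/forallP => k; rewrite inE.
Qed.

(** The normalization absorbs the count of idle letters:
    [(n - d)! * (n - k) ^_ (d - k) = (n - k)!]. *)
Lemma P_expand n d (f g : 'I_n -> {linear H -> H}) x : (d <= n)%N ->
    (forall i y, g i y = f i y + y) ->
  P d (fun i => g i : H -> H) x =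
  \sum_(k < d.+1) subset_weight C n d k *: distinct_sum f k x.
Proof.
move=> dn gE; rewrite P_inj_words (inj_words_add_id d finset.set0 x gE) scaler_sumr.
apply: eq_bigr => k _; rewrite distinct_sum_inj_words -[inj_words _ _ _ _ *+ _]scaler_nat scalerA.
congr (_ *: _); rewrite /subset_weight cards0 subn0 card_ord mulrAC -natrM.
congr (_%:R / _); rewrite mulnCA; congr (_ * _)%N.
have kd : (k <= d)%N by rewrite -ltnS.
rewrite mulnC -(ffact_fact (leq_sub2r k dn)); congr (_ * _`!)%N.
by rewrite -subnDA subnKC.
Qed.

Lemma distinct_sum0 n (f : 'I_n -> {linear H -> H}) x : distinct_sum f 0 x = x.
Proof. by rewrite distinct_sum_inj_words. Qed.

Lemma distinct_sum1 n (f : 'I_n -> {linear H -> H}) x :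
  distinct_sum f 1 x = \sum_i f i x.
Proof. by rewrite distinct_sum_inj_words /=; apply: eq_bigl => i; rewrite inE. Qed.

(** For fixed [i], the sum of the [f j x] over [j != i] is [- f i x]. *)
Lemma distinct_sum2 n (f : 'I_n -> {linear H -> H}) x :
  (forall y, \sum_i f i y = 0) -> distinct_sum f 2 x = - \sum_i f i (f i x).
Proof.
move=> f_sum0; rewrite distinct_sum_inj_words /= -sumrN; apply: eq_big => [i|i _].
  by rewrite inE.
have := f_sum0 x; rewrite (bigD1 i) //= => /eqP; rewrite addrC addr_eq0 => /eqP fiE.
rewrite -linearN -fiE; congr (f i _); apply: eq_bigl => j; by rewrite !inE orbF.
Qed.

Lemma bounded_opD (S T : H -> H) : bounded_op S -> bounded_op T -> bounded_op (S + T).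
Proof.
move=> [S_linear [M S_le]] [T_linear [N T_le]]; split.
  by move=> a x y; rewrite !fctE S_linear T_linear scalerDr addrACA.
exists (M + N) => x; rewrite fctE rmorphD mulrDl.
by rewrite (le_trans (ler_normD _ _)) // lerD.
Qed.

Lemma bounded_opN (S : H -> H) : bounded_op S -> bounded_op (- S).
Proof.
move=> [S_linear [M S_le]]; split.
  by move=> a x y; rewrite !fctE S_linear opprD scalerN.
by exists M => x; rewrite fctE normrN.
Qed.

Lemma bounded_op_id : bounded_op (idfun : H -> H).
Proof. by split=> [a x y //|]; exists 1 => x; rewrite mul1r. Qed.

Lemma bounded_op_comp (S T : H -> H) :
  bounded_op S -> bounded_op T -> bounded_op (S \o T).
Proof.
move=> [S_linear [M S_le]] [T_linear [N T_le]]; split.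
  by move=> a x y /=; rewrite T_linear S_linear.
exists (`|M| * N) => x /=; rewrite rmorphM -mulrA.
apply: le_trans (S_le _) _; apply: (@le_trans _ _ ((`|M|%:C)%C * `|T x|)).
  by rewrite ler_wpM2r // lecR ler_norm.
by rewrite ler_wpM2l // ler0c.
Qed.

Lemma bounded_op_sum (I : finType) (T : I -> H -> H) :
  (forall i, bounded_op (T i)) -> bounded_op (\sum_i T i).
Proof.
move=> T_bnd; apply: (big_ind (@bounded_op R H)) => //; last exact: bounded_opD.
split=> [a x y|]; first by rewrite -[RHS]/(a *: 0 + 0) scaler0 addr0.
by exists 0 => x; rewrite -[`|_|]/(`|0 : H|) normr0 mul0r.
Qed.

Lemma linear_of_bounded_op (S : H -> H) :
  bounded_op S -> exists S' : {linear H -> H}, S' = S :> (H -> H).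
Proof.
move=> [S_linear _].
pose S' : {linear H -> H} := HB.pack S (GRing.isLinear.Build C H H _ S S_linear).
by exists S'.
Qed.

Lemma op_norm_ge0 (S : H -> H) : 0 <= op_norm S.
Proof.
rewrite /op_norm; set E := (X in sup X).
have [E_sup|/sup_out -> //] := pselect (has_sup E).
have : 0 <= complex.Re `|S 0| by rewrite -ler0c RRe_real // ger0_real.
move=> /le_trans; apply; apply: sup_upper_bound => //.
by exists 0 => //=; rewrite normr0 ler01.
Qed.

Lemma op_exp_id d : op_exp (idfun : H -> H) d = idfun.
Proof. by rewrite /op_exp big1_eq. Qed.

Lemma P_le_id n d (f g : 'I_n -> {linear H -> H}) :
    (d <= n)%N ->
    (forall i y, g i y = f i y + y) ->
    (forall i, selfadjoint dot (f i)) ->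
    (forall y, \sum_i f i y = 0) ->
    (forall x, \sum_i dot (f i x) (f i x) <= (n%:R / (3 * d%:R)) ^+ 2 * dot x x) ->
  op_le dot (P d (fun i => g i : H -> H)) idfun.
Proof.
move=> dn gE f_sa f_sum0 f_le x.
have g_sa i : selfadjoint dot (g i).
  by move=> y z; rewrite !gE dotDl dotDr f_sa.
set Pg := P d _; have Pg_sa : selfadjoint dot Pg by apply: selfadjoint_P.
rewrite -[(idfun - Pg) x]/(x - Pg x) -scaleN1r dotDl dotZl mulN1r subr_ge0.
(* For [d] at most 1 the expansion stops at [E_1 = 0] and equality holds; from [d = m.+2] on the
   term of order 2 is available. *)
case: d dn @Pg f_le Pg_sa => [|[|m]] dn Pg f_le Pg_sa.
- rewrite /Pg (P_expand x dn gE) big_ord1 distinct_sum0.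
  by rewrite /subset_weight bin0 mul1n subn0 divff ?scale1r // pnatr_eq0 -lt0n fact_gt0.
- rewrite /Pg (P_expand x dn gE) !big_ord_recl big_ord0 distinct_sum0 distinct_sum1.
  rewrite f_sum0 scaler0 addr0 addr0.
  by rewrite /subset_weight bin0 mul1n subn0 divff ?scale1r // pnatr_eq0 -lt0n fact_gt0.
have n_gt0 : (0 < n)%N by apply: leq_trans dn.
pose q := \sum_i dot (f i x) (f i x).
have q_ge0 : 0 <= q by apply: sumr_ge0 => i _; apply: dot_ge0.
pose t := subset_weight C n m.+2; pose rho : C := n%:R / (3 * m.+2%:R).
have rho_ge0 : 0 <= rho by rewrite divr_ge0 ?mulr_ge0.
pose tail := \sum_(0 <= k < m) t k.+3 * dot (distinct_sum f k.+3 x) x.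
have dotP : dot (Pg x) x = dot x x - t 2 * q + tail.
  rewrite /Pg (P_expand x dn gE) linear_sumlz.
  rewrite (eq_bigr (fun k : 'I_m.+3 => t k * dot (distinct_sum f k x) x)); last first.
    by move=> k _; apply: dotZl.
  rewrite -(big_mkord xpredT (fun k => t k * dot (distinct_sum f k x) x)).
  rewrite !big_nat_recl // distinct_sum0 distinct_sum1 distinct_sum2 // f_sum0.
  rewrite linear0l mulr0 add0r addrA -/tail; congr (_ + _ + _).
    by rewrite /t /subset_weight bin0 mul1n subn0 divff ?mul1r // pnatr_eq0 -lt0n fact_gt0.
  rewrite linearNl mulrN linear_sumlz; congr (- (_ * _)); apply: eq_bigr => i _.
  exact: f_sa.
(* In [R[i]] a number is bounded by its norm only if it is real; self-adjointness of [Pg] provides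
   this. *)
have tail_real : tail \is Num.real.
  rewrite (_ : tail = dot (Pg x) x - dot x x + t 2 * q); last by rewrite dotP; ring.
  have Pg_real : dot (Pg x) x \is Num.real by apply/CrealP; rewrite -dotC Pg_sa.
  have x_real : dot x x \is Num.real by rewrite ger0_real // dot_ge0.
  have tq_real : t 2 * q \is Num.real by rewrite ger0_real // mulr_ge0 ?subset_weight_ge0.
  by rewrite rpredD ?rpredB.
rewrite dotP -[leRHS](subrK (t 2 * q)) lerD2l.
apply: le_trans (real_ler_norm tail_real) _.
apply: le_trans (ler_norm_sum _ _ _) _.
apply: le_trans (ler_wpM2r q_ge0 (subset_weight_tail C dn)).
rewrite mulr_suml; apply: ler_sum => k _.
rewrite normrM ger0_norm ?subset_weight_ge0 // -[leRHS]mulrA ler_wpM2l ?subset_weight_ge0 //.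
apply: (distinct_sum_le _ f_sa f_sum0 rho_ge0 f_le) => //.
by rewrite card_ord.
Qed.

End Products.

Theorem theorem1p3 (R : realType) (H : completeNormedModType R[i])
    (dot : {dot H for (@Num.conj R[i])}) (hdot : hilbert_dot dot)
    (n d : nat) (hd1 : (1 <= d)%N) (hdn : (d <= n)%N)
    (A : 'I_n -> H -> H)
    (hA : forall i : 'I_n, bounded_op (A i) /\ selfadjoint dot (A i))
    (a := fun i : 'I_n => A i - idfun : H -> H)
    (hi : P 1 A = idfun)
    (hii : op_norm (op_sqrt dot (\sum_(j < n) (a j \o a j)))
           <= n%:R / (3%:R * d%:R)) :
  op_le dot (P d A) (op_exp (P 1 A) d) /\ op_exp (P 1 A) d = idfun.
Proof.
rewrite hi op_exp_id; split=> //.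
have n_gt0 : (0 < n)%N by apply: leq_trans hdn.
have a_bnd i : bounded_op (a i).
  by apply: bounded_opD (bounded_opN (@bounded_op_id _ _)); case: (hA i).
have a_sa i : selfadjoint dot (a i).
  move=> x y; rewrite /a -[(A i - idfun) x]/(A i x - x) -[(A i - idfun) y]/(A i y - y).
  by rewrite linearBl linearBr /= (hA i).2.
have [f fE] := choice (fun i => linear_of_bounded_op (a_bnd i)).
have [g gE] := choice (fun i => linear_of_bounded_op (hA i).1).
have gfE i y : g i y = f i y + y.
  by rewrite gE fE /a -[(A i - idfun) y]/(A i y - y) subrK.
have f_sa i : selfadjoint dot (f i) by rewrite fE.
have AE : A = (fun i => g i : H -> H) by apply/funext => i; rewrite gE.
(* Expanding hypothesis (i) with [d = 1] gives the identity plus a nonzero multiple of the sum of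
   the [f i]. *)
have f_sum0 y : \sum_i f i y = 0.
  have /(congr1 (fun T => T y)) := hi.
  rewrite AE (P_expand y n_gt0 gfE) !big_ord_recl big_ord0 distinct_sum0 distinct_sum1.
  rewrite /subset_weight /= !bin0 binn !mul1n subn0 divff; last first.
    by rewrite pnatr_eq0 -lt0n fact_gt0.
  rewrite scale1r addr0 => /eqP; rewrite -subr_eq0 addrAC subrr add0r.
  by rewrite scaler_eq0 mulf_eq0 invr_eq0 !pnatr_eq0 !eqn0Ngt !fact_gt0 => /eqP.
rewrite AE; apply: (P_le_id hdn gfE f_sa f_sum0) => x.
have sum_bnd : bounded_op (\sum_(j < n) (a j \o a j)).
  by apply: bounded_op_sum => j; apply: bounded_op_comp.
(* Hypothesis (ii) bounds the norm of the square root of [Q], hence the quadratic form of [Q] by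
   [rho ^+ 2], as [P_le_id] requires. *)
have [Q QE] := linear_of_bounded_op sum_bnd.
have dotQ y : dot (Q y) y = \sum_i dot (f i y) (f i y).
  rewrite QE fct_sumE linear_sumlz; apply: eq_bigr => i _ /=.
  by rewrite a_sa fE.
have Q_psd : psd dot Q.
  by move=> y; rewrite dotQ; apply: sumr_ge0 => i _; apply: dot_ge0.
have Q_bnd : bounded_op Q by rewrite QE.
rewrite -dotQ; apply: le_trans (dot_psd_le_op_sqrt hdot x Q_bnd Q_psd) _.
rewrite ler_wpM2r ?dot_ge0 // QE ler_pXn2r ?nnegrE ?divr_ge0 ?mulr_ge0 //.
  rewrite (_ : n%:R / _ = ((n%:R / (3%:R * d%:R) : R)%:C)%C) ?lecR //.
  by rewrite rmorphM fmorphV rmorphM !rmorph_nat.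
by rewrite ler0c op_norm_ge0.
Qed.
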